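(* Let $a<b$ be real numbers. (1) Let $f:[a,b]\to\mathbb{R}$ be an integrable $\phi$-convex function with (measurable) error function $\phi:[0,b-a]\to\mathbb{R}_+$. Then $$f\left(\frac{a+b}{2}\right)-\frac{1}{b-a}\int_a^b\phi\left(\left|t-\frac{a+b}{2}\right|\right)dt\ \le\ \frac{1}{b-a}\int_a^b f(t)\,dt$$ and $$\frac{1}{b-a}\int_a^b f(t)\,dt\ \le\ \frac{f(a)+f(b)}{2}+\frac{1}{(b-a)^2}\int_a^b\big[(b-t)\,\phi(t-a)+(t-a)\,\phi(b-t)\big]dt.$$ (2) Let $f:[a,b]\to\mathbb{R}$ be an integrable uniformly convex function with (measurable) modulus $\Phi:[0,b-a]\to\mathbb{R}_+$. Then $$f\left(\frac{a+b}{2}\right)+\frac{1}{b-a}\int_a^b\Phi\left(\left|t-\frac{a+b}{2}\right|\right)dt\ \le\ \frac{1}{b-a}\int_a^b f(t)\,dt$$ and $$\frac{1}{b-a}\int_a^b f(t)\,dt\ \le\ \frac{f(a)+f(b)}{2}-\frac16\,\Phi\left(|b-a|\right).$$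
   Context: $\mathbb{R}_+=[0,\infty)$. Integrals of nonnegative measurable functions are allowed to take the value $+\infty$. A function $f:[a,b]\to\mathbb{R}$ is $\phi$-convex with error function $\phi:[0,b-a]\to\mathbb{R}_+$ if for all $x,y\in[a,b]$ and $t\in[0,1]$, $$tf(x)+(1-t)f(y)+t\,\phi\big((1-t)|x-y|\big)+(1-t)\,\phi\big(t|x-y|\big)\ \ge\ f\big(tx+(1-t)y\big).$$ A function $f:[a,b]\to\mathbb{R}$ is uniformly convex with modulus $\Phi:[0,b-a]\to\mathbb{R}_+$ if for all $x,y\in[a,b]$ and $t\in[0,1]$, $$tf(x)+(1-t)f(y)\ \ge\ f\big(tx+(1-t)y\big)+t(1-t)\,\Phi\big(|x-y|\big).$$ *)

(* Defs.v *)
From HB Require Import structures.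
From mathcomp Require Import all_boot all_order all_algebra.
From mathcomp Require Import all_classical all_reals all_analysis.

Set Implicit Arguments.
Unset Strict Implicit.
Unset Printing Implicit Defensive.

Import Order.TTheory GRing.Theory Num.Theory.
Local Open Scope classical_set_scope.
Local Open Scope ring_scope.

(* Functions on [a, b] or [0, b - a] are total functions R -> R of which only
   the values on that interval are constrained. *)

Definition phi_convex (R : realType) (a b : R) (phi f : R -> R) : Prop :=
  (forall r, r \in `[0, b - a] -> 0 <= phi r) /\
  (forall x y t, x \in `[a, b] -> y \in `[a, b] -> t \in `[0, 1] ->
     f (t * x + (1 - t) * y) <=
       t * f x + (1 - t) * f y
       + t * phi ((1 - t) * `|x - y|) + (1 - t) * phi (t * `|x - y|)).

Definition uniformly_convex (R : realType) (a b : R) (Phi f : R -> R) : Prop :=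
  (forall r, r \in `[0, b - a] -> 0 <= Phi r) /\
  (forall x y t, x \in `[a, b] -> y \in `[a, b] -> t \in `[0, 1] ->
     f (t * x + (1 - t) * y) + t * (1 - t) * Phi `|x - y| <=
       t * f x + (1 - t) * f y).

(* [lebesgue_measure] lives on the Borel sets; the completed measure is used so
   that measurability and integrability are in the sense of Lebesgue. The type
   [lebesgueR R] is R equipped with the Lebesgue sigma-algebra; the codomain of
   a measurable function keeps the Borel sigma-algebra. *)
Notation lebesgueR R := (caratheodory_type (wlength (@idfun (Real.sort R)))^*%mu).

Definition lebesgue_measurable_on (R : realType) (D : set R) (g : R -> R) :
    Prop :=
  measurable_fun (D : set (lebesgueR R)) (g : lebesgueR R -> R).

Definition lebesgue_integrable_on (R : realType) (D : set R) (g : R -> R) :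
    Prop :=
  (@completed_lebesgue_measure R).-integrable D (EFin \o g).

Definition lebesgue_int (R : realType) (D : set R) (g : R -> R) : \bar R :=
  (\int[@completed_lebesgue_measure R]_(t in D) (g t)%:E)%E.

(* Main.v *)
Require Import Defs.
From HB Require Import structures.
From mathcomp Require Import all_boot all_order all_algebra.
From mathcomp Require Import all_classical all_reals all_analysis.
From mathcomp Require Import measurable_realfun ring lra.

(** Hermite-Hadamard inequalities come from two pointwise inequalities.

    Lower bounds. Pair each point [t] of [[a, b]] with its mirror image
    [a + b - t]: convexity at their midpoint [m = (a + b) / 2] bounds [f m] by
    the average of [f t] and [f (a + b - t)], up to an error term in
    [`|t - m|]. Integrating over [[a, b]] replaces that average by the mean of
    [f], because the integral is invariant under the reflection
    ([midpoint_integral]). For a phi-convex function the error is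
    [phi `|t - m|], directly from the definition with weight 1/2. For a
    uniformly convex function the definition only gives a quarter of
    [Phi (2 * `|t - m|)], and [Phi] is not assumed to grow quadratically; the
    gain [Phi `|t - m|] is obtained by convexity on the two half-segments
    around [m] and then on the segment joining their midpoints, three segments
    which all have length [`|t - m|] ([uniformly_convex_midpoint]).

    Upper bounds. Writing [t] as a barycenter of [a] and [b] bounds [f] by its
    chord plus an error term. Over [[a, b]] the chord has mean
    [(f a + f b) / 2], and the weight [(b - t) * (t - a) / (b - a) ^+ 2] of the
    modulus has mean 1/6 ([chord_integral]).

    The integrals of phi may be infinite: a nonnegative measurable function is
    either integrable or has integral [+oo] ([ge0_integrable_or_pinfty]), and
    in the second case the bounds are trivial. In the lower bound for uniformly
    convex functions, [Phi `|t - m|] is dominated by an integrable function, so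
    this case does not arise.

    Measurability is meant in the sense of Lebesgue, so composing with a
    reflection, a translation or a distance must preserve Lebesgue (not just
    Borel) measurable sets. A Lebesgue measurable set lies between a Borel set
    and its union with a Borel null set, and reflections preserve the measure of
    Borel sets, so that completeness of the measure settles the case of
    reflections; a translation is a product of two of them. *)

Import Order.TTheory GRing.Theory Num.Theory.
Import numFieldNormedType.Exports.
Local Open Scope classical_set_scope.
Local Open Scope ring_scope.

(** * Reflections and the completed Lebesgue measure *)

Section LebesgueMeasurability.
Local Set Implicit Arguments.
Local Unset Strict Implicit.
Context {R : realType}.
Notation cmu := (@completed_lebesgue_measure R).
Notation lmu := (@lebesgue_measure R).
Implicit Types (a b c : R) (A : set R).

Lemma borel_lebesgue_measurable A :
  measurable (A : set (measurableTypeR R)) ->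
  measurable (A : set (lebesgueR R)).
Proof. by move=> mA; exact: sub_caratheodory. Qed.

Lemma itv_lebesgue_measurable (i : interval R) :
  measurable ([set` i] : set (lebesgueR R)).
Proof. by apply: borel_lebesgue_measurable; exact: measurable_itv. Qed.

Lemma lebesgue_measurable_id :
  measurable_fun setT (fun t : lebesgueR R => t : measurableTypeR R).
Proof. by move=> _ A mA; rewrite setTI; exact: borel_lebesgue_measurable. Qed.

(** The Caratheodory sigma-algebra is the completion of the Borel one. *)
Lemma lebesgue_measurable_borel_split A :
  measurable (A : set (lebesgueR R)) ->
  exists X B, [/\ measurable (X : set (measurableTypeR R)),
    measurable (B : set (measurableTypeR R)), lmu B = 0%E
    & X `<=` A /\ A `<=` X `|` B].
Proof.
rewrite -completed_caratheodory_measurable g_sigma_completed_algebra_genE.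
move=> -[X mX [N [B [mB B0 NB]]] <-]; exists X, B; split => //.
by split; [exact: subsetUl | exact: setUS].
Qed.

Lemma borel_measurable_reflection c :
  measurable_fun setT (fun t : measurableTypeR R => c - t : measurableTypeR R).
Proof. by apply: measurable_funB. Qed.

(** A measure on Borel sets is determined by its values on half-open intervals,
    and a reflection preserves the length of these, although it exchanges the
    open end with the closed one. *)
Lemma borel_measure_reflection c A : measurable (A : set (measurableTypeR R)) ->
  lmu ((fun t : R => c - t) @^-1` A) = lmu A.
Proof.
move=> mA; rewrite -[LHS]/(pushforward lmu
  (fun t : measurableTypeR R => c - t : measurableTypeR R) A).
apply/esym/lebesgue_measure_unique => //=.
  exact: borel_measurable_reflection.
move=> _ _ [[u v] _ <-]; rewrite /pushforward/=.
have -> : (fun t : R => c - t) @^-1` `]u, v] = `[c - v, c - u[%classic.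
  apply/seteqP; split=> t /=; rewrite !in_itv/= => /andP[? ?];
  by apply/andP; split; lra.
rewrite !lebesgue_measure_itv/= !lte_fin ltrD2l ltrN2.
by case: ifP => // _; congr (_%:E); ring.
Qed.

(** Squeezing [A] between Borel sets gives measurability of its mirror image by
    completeness, and one inequality between the measures; the other one follows
    because a reflection is an involution. *)
Lemma lebesgue_measurable_reflection_preimage c A :
  measurable (A : set (lebesgueR R)) ->
  measurable ((fun t : R => c - t) @^-1` A : set (lebesgueR R)) /\
  (cmu ((fun t : R => c - t)%R @^-1` A) <= cmu A)%E.
Proof.
set r := (fun t : R => c - t) => mA.
have [X [B [mX mB B0 [XA AXB]]]] := lebesgue_measurable_borel_split mA.
have mr S : measurable (S : set (measurableTypeR R)) ->
    measurable (r @^-1` S : set (measurableTypeR R)).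
  move=> mS; rewrite -(setTI (_ @^-1` _)).
  exact: borel_measurable_reflection.
have rB0 : cmu (r @^-1` B) = 0%E.
  exact: etrans (borel_measure_reflection c mB) B0.
have mrA : measurable (r @^-1` A : set (lebesgueR R)).
  have -> : r @^-1` A = r @^-1` X `|` (r @^-1` (A `\` X)).
    by rewrite -preimage_setU setDUK.
  apply: measurableU; first by apply: borel_lebesgue_measurable; exact: mr.
  apply: completed_lebesgue_measure_is_complete; exists (r @^-1` B); split=> //.
    by apply: borel_lebesgue_measurable; exact: mr.
  by move=> t [/AXB[Xt|Bt] nXt].
split=> //; apply: (@le_trans _ _ (cmu (r @^-1` X `|` r @^-1` B))).
  apply: le_outer_measure; rewrite -preimage_setU; exact: preimage_subset.
apply: (@le_trans _ _ (cmu (r @^-1` X) + cmu (r @^-1` B))%E).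
  exact: outer_measureU2.
have -> : cmu (r @^-1` X) = cmu X by exact: (borel_measure_reflection c mX).
by rewrite rB0 adde0; exact: le_outer_measure.
Qed.

Lemma lebesgue_measurable_reflection c :
  measurable_fun setT (fun t : lebesgueR R => c - t : lebesgueR R).
Proof.
move=> _ A mA; rewrite setTI.
by case: (lebesgue_measurable_reflection_preimage c mA).
Qed.

Lemma lebesgue_measure_reflection c A : measurable (A : set (lebesgueR R)) ->
  cmu ((fun t : R => c - t) @^-1` A) = cmu A.
Proof.
move=> mA; have [mrA rA] := lebesgue_measurable_reflection_preimage c mA.
apply/eqP; rewrite eq_le rA/=.
have [_] := lebesgue_measurable_reflection_preimage c mrA.
suff -> : (fun t : R => c - t) @^-1` ((fun t => c - t) @^-1` A) = A by [].
by apply/seteqP; split=> t /=; rewrite subKr.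
Qed.

Lemma lebesgue_measurable_translation c :
  measurable_fun setT (fun t : lebesgueR R => t - c : lebesgueR R).
Proof.
have -> : (fun t : lebesgueR R => t - c : lebesgueR R) =
    (fun t : lebesgueR R => 0 - t : lebesgueR R) \o
    (fun t : lebesgueR R => c - t : lebesgueR R).
  by apply/funext => t /=; ring.
apply: measurableT_comp; exact: lebesgue_measurable_reflection.
Qed.

Lemma lebesgue_measurable_dist c :
  measurable_fun setT (fun t : lebesgueR R => `|t - c| : lebesgueR R).
Proof.
have -> : [set: lebesgueR R] = `]-oo, c] `|` `[c, +oo[.
  by apply/esym/seteqP; split=> t //= _; case: (leP t c) => tc; [left|right];
    rewrite in_itv/= ?andbT// ltW.
apply/measurable_funU; [exact: itv_lebesgue_measurable.. | split].
- apply: (@eq_measurable_fun _ _ (lebesgueR R) (lebesgueR R) _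
    (fun t => c - t : lebesgueR R)); last first.
    exact/measurable_funTS/lebesgue_measurable_reflection.
  move=> t; rewrite inE/= in_itv/= => tc.
  by rewrite ler0_norm ?opprB// subr_le0.
- apply: (@eq_measurable_fun _ _ (lebesgueR R) (lebesgueR R) _
    (fun t => t - c : lebesgueR R)); last first.
    exact/measurable_funTS/lebesgue_measurable_translation.
  move=> t; rewrite inE/= in_itv/= andbT => tc.
  by rewrite ger0_norm// subr_ge0.
Qed.

(** The Lebesgue measure on Borel sets is the image of the completed one by the
    identity. *)
Lemma integral_lebesgueE (D : set R) (f : R -> \bar R) :
  measurable (D : set (measurableTypeR R)) ->
  measurable_fun [set: measurableTypeR R] f -> lmu.-integrable D f ->
  (cmu.-integrable D f /\ \int[cmu]_(t in D) f t = \int[lmu]_(t in D) f t)%E.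
Proof.
move=> mD mf intf; have mid := lebesgue_measurable_id.
have mfc : measurable_fun [set: lebesgueR R] f.
  by apply: (measurableT_comp
    (g := (fun t : lebesgueR R => t : measurableTypeR R)) mf mid).
have icf : cmu.-integrable D f.
  apply/integrableP; split; first exact: measurable_funTS.
  move/integrableP: intf => [_]; apply: le_lt_trans.
  have mabs : measurable_fun D (abse \o f : measurableTypeR R -> \bar R).
    apply: measurable_funTS.
    exact: (measurableT_comp (@abse_measurable R setT) mf).
  have /= := ge0_integral_pushforward mid cmu mD mabs.
  by move=> <-.
split=> //; exact: esym (integral_pushforward mid mf icf mD).
Qed.

Lemma ge0_integral_reflection a b (g : R -> \bar R) :
  measurable_fun (`[a, b]%classic : set (lebesgueR R)) g ->
  (forall t, t \in `[a, b] -> 0 <= g t)%E ->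
  (\int[cmu]_(t in `[a, b]) g (a + b - t)%R = \int[cmu]_(t in `[a, b]) g t)%E.
Proof.
move=> mg g0; pose D := `[a, b]%classic : set (lebesgueR R).
have mD : measurable D by exact: itv_lebesgue_measurable.
pose r := fun t : lebesgueR R => a + b - t : lebesgueR R.
have rD : r @^-1` D = D.
  apply/seteqP; split=> t; rewrite /r /D /= !in_itv/= => /andP[? ?];
  by apply/andP; split; lra.
have mr : measurable_fun setT r by exact: lebesgue_measurable_reflection.
have := ge0_integral_pushforward mr cmu mD mg.
rewrite rD => <-; last by move=> t; rewrite inE; exact: g0.
apply: eq_measure_integral => A mA _; exact: lebesgue_measure_reflection.
Qed.

Lemma integral_reflection a b (f : R -> R) :
  lebesgue_integrable_on `[a, b] f ->
  lebesgue_integrable_on `[a, b] (fun t => f (a + b - t)) /\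
  lebesgue_int `[a, b] (fun t => f (a + b - t)) = lebesgue_int `[a, b] f.
Proof.
move=> intf.
pose D := `[a, b]%classic : set (lebesgueR R).
have mD : measurable D by exact: itv_lebesgue_measurable.
have mf := measurable_int cmu intf.
split; last first.
  rewrite /lebesgue_int integralE [RHS]integralE; congr (_ - _)%E.
    have mp := measurable_funepos mf.
    rewrite -[RHS](ge0_integral_reflection mp (fun t _ => funepos_ge0 _ t)).
    by apply: eq_integral => t _; rewrite !funeposE.
  have mn := measurable_funeneg mf.
  rewrite -[RHS](ge0_integral_reflection mn (fun t _ => funeneg_ge0 _ t)).
  by apply: eq_integral => t _; rewrite !funenegE.
apply/integrableP; split.
  apply: (measurable_comp (F := D)
    (g := (fun t : lebesgueR R => a + b - t : lebesgueR R)) mD _ mf).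
    move=> _ [t /= + <-]; rewrite /D/= !in_itv/= => /andP[? ?].
    by apply/andP; split; lra.
  exact/measurable_funTS/lebesgue_measurable_reflection.
rewrite (@ge0_integral_reflection a b (fun t => `|(f t)%:E|%E))//.
  by case/integrableP: intf.
exact: measurableT_comp.
Qed.

Lemma lebesgue_int_deriv_horner (P : {poly R}) a b : a < b ->
  lebesgue_integrable_on `[a, b] (horner P^`()) /\
  lebesgue_int `[a, b] (horner P^`()) = (P.[b] - P.[a])%:E.
Proof.
move=> ab.
have mD := @measurable_itv R `[a, b].
have cP (Q : {poly R}) : continuous (horner Q) by exact: continuous_horner.
have [] := @integral_lebesgueE `[a, b] (EFin \o horner P^`()) mD.
- apply/measurable_EFinP.
  have := continuous_measurable_fun (cP P^`()).
  exact.
- apply: continuous_compact_integrable; first exact: segment_compact.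
  exact/continuous_subspaceT.
move=> intP eP; split=> //; rewrite /lebesgue_int [LHS]eP EFinB.
apply: continuous_FTC2 => //.
- exact/continuous_subspaceT.
- split; [by move=> x _; exact: derivable_horner | |].
    exact/cvg_at_right_filter/cP.
  exact/cvg_at_left_filter/cP.
- by move=> x _; rewrite derivE.
Qed.

End LebesgueMeasurability.

(** * Pointwise consequences of convexity *)

Section Pointwise.
Local Set Implicit Arguments.
Local Unset Strict Implicit.
Context {R : realType}.
Variables (a b : R) (f phi : R -> R).
Hypothesis ab : a < b.
Implicit Types t : R.

Let mirror_itv t : t \in `[a, b] -> a + b - t \in `[a, b].
Proof. by rewrite !in_itv/= => /andP[? ?]; apply/andP; split; lra. Qed.

Let half_itv : 1 / 2 \in `[0, 1 : R].
Proof. by rewrite in_itv/=; apply/andP; split; lra. Qed.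

Let endpoints_itv : a \in `[a, b] /\ b \in `[a, b].
Proof. by rewrite !in_itv/= !lexx (ltW ab). Qed.

Lemma barycenter_itv t : t \in `[a, b] ->
  [/\ (b - t) / (b - a) \in `[0, 1 : R],
      (b - t) / (b - a) * a + (1 - (b - t) / (b - a)) * b = t,
      (b - t) / (b - a) * `|a - b| = b - t &
      (1 - (b - t) / (b - a)) * `|a - b| = t - a].
Proof.
rewrite in_itv/= => /andP[at_ tb].
have ba0 : 0 < b - a by rewrite subr_gt0.
have ba_neq0 : b - a != 0 by rewrite gt_eqF.
rewrite ltr0_norm ?subr_lt0// opprB; split; [|by field..].
by rewrite in_itv/= divr_ge0 ?subr_ge0 ?(ltW ab)//= ler_pdivrMr// mul1r; lra.
Qed.

Lemma phi_convex_midpoint t : phi_convex a b phi f -> t \in `[a, b] ->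
  f ((a + b) / 2) <= (f t + f (a + b - t)) / 2 + phi `|t - (a + b) / 2|.
Proof.
move=> [_ cf] tab; have := cf _ _ _ tab (mirror_itv tab) half_itv.
have -> : 1 - 1 / 2 = 1 / 2 :> R by field.
have -> : 1 / 2 * `|t - (a + b - t)| = `|t - (a + b) / 2|.
  have /ger0_norm {1}<- : 0 <= 1 / 2 :> R by lra.
  by rewrite -normrM; congr `|_|; field.
have -> : 1 / 2 * t + 1 / 2 * (a + b - t) = (a + b) / 2 by field.
by move=> h; lra.
Qed.

Lemma phi_convex_chord t : phi_convex a b phi f -> t \in `[a, b] ->
  f t <= ((b - t) * f a + (t - a) * f b) / (b - a)
         + ((b - t) * phi (t - a) + (t - a) * phi (b - t)) / (b - a).
Proof.
move=> [_ cf] tab; have [aab bab] := endpoints_itv.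
have [lab lE l1 l2] := barycenter_itv tab.
have := cf _ _ _ aab bab lab; rewrite lE l1 l2.
have ba_neq0 : b - a != 0 by rewrite subr_eq0 gt_eqF.
move=> /le_trans; apply; rewrite le_eqVlt; apply/orP; left; apply/eqP.
by field.
Qed.

(** Let [m] be the midpoint, [s] the mirror image of [t], [u] the midpoint of
    [t] and [m], [v] that of [s] and [m], and [d = `|t - m|]. The segments
    [[t, m]], [[s, m]] and [[u, v]] all have length [d], and their midpoints are
    [u], [v] and [m]. If [E] is the gap between the average of [f] at [t] and [s]
    and its value at [m], the first two segments bound the corresponding gap for
    [u] and [v] by [E / 2 - phi d / 4], and the third one bounds it below by
    [phi d / 4]; hence [phi d <= E]. *)
Lemma uniformly_convex_midpoint t : uniformly_convex a b phi f ->
  t \in `[a, b] ->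
  f ((a + b) / 2) + phi `|t - (a + b) / 2| <= (f t + f (a + b - t)) / 2.
Proof.
move=> [_ cf] tab; set m := (a + b) / 2; set d := `|t - m|.
have mab : m \in `[a, b].
  by have := ab; rewrite /m in_itv/= => ab0; apply/andP; split; lra.
pose u := (t + m) / 2; pose v := (a + b - t + m) / 2.
have htab := tab; rewrite in_itv/= in htab; have {htab} /andP[at_ tb] := htab.
have uab : u \in `[a, b] by rewrite /u /m in_itv/=; apply/andP; split; lra.
have vab : v \in `[a, b] by rewrite /v /m in_itv/=; apply/andP; split; lra.
have h12 : 1 - 1 / 2 = 1 / 2 :> R by field.
have := cf _ _ _ tab mab half_itv.
have := cf _ _ _ (mirror_itv tab) mab half_itv.
have := cf _ _ _ uab vab half_itv.
rewrite h12 -/d.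
have -> : `|u - v| = d by rewrite /d /u /v /m; congr `|_|; field.
have -> : `|a + b - t - m| = d.
  by rewrite /d -normrN; congr `|_|; rewrite /m; field.
have -> : 1 / 2 * u + 1 / 2 * v = m by rewrite /u /v /m; field.
have -> : 1 / 2 * (a + b - t) + 1 / 2 * m = v by rewrite /v; field.
have -> : 1 / 2 * t + 1 / 2 * m = u by rewrite /u; field.
by move=> ? ? ?; lra.
Qed.

Lemma uniformly_convex_chord t : uniformly_convex a b phi f ->
  t \in `[a, b] ->
  f t <= ((b - t) * f a + (t - a) * f b) / (b - a)
         - phi (b - a) / (b - a) ^+ 2 * ((b - t) * (t - a)).
Proof.
move=> [_ cf] tab; have [aab bab] := endpoints_itv.
have [lab lE _ _] := barycenter_itv tab.
have := cf _ _ _ aab bab lab; rewrite lE ltr0_norm ?subr_lt0// opprB.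
have ba_neq0 : b - a != 0 by rewrite subr_eq0 gt_eqF.
rewrite -lerBrDr => /le_trans; apply.
by rewrite le_eqVlt; apply/orP; left; apply/eqP; field.
Qed.

End Pointwise.

(** * Integrating the pointwise inequalities *)

Section Integrated.
Local Set Implicit Arguments.
Local Unset Strict Implicit.
Context {R : realType}.
Variables (a b : R).
Notation cmu := (@completed_lebesgue_measure R).
Let D : set (lebesgueR R) := `[a, b].
Let mD : measurable D. Proof. exact: itv_lebesgue_measurable. Qed.
Implicit Types f g h e : R -> R.

Lemma lebesgue_int_Rintegral g : lebesgue_integrable_on `[a, b] g ->
  lebesgue_int `[a, b] g = (\int[cmu]_(t in `[a, b]) g t)%:E.
Proof. by move=> ig; rewrite /Rintegral fineK//; exact: integrable_fin_num. Qed.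

Lemma lebesgue_integrable_onD g h :
  lebesgue_integrable_on `[a, b] g -> lebesgue_integrable_on `[a, b] h ->
  lebesgue_integrable_on `[a, b] (fun t => g t + h t).
Proof.
rewrite /lebesgue_integrable_on => ig ih.
exact: eq_integrable (integrableD mD ig ih).
Qed.

Lemma lebesgue_integrable_onZ (k : R) g :
  lebesgue_integrable_on `[a, b] g ->
  lebesgue_integrable_on `[a, b] (fun t => k * g t).
Proof.
rewrite /lebesgue_integrable_on => ig.
exact: eq_integrable (integrableZl mD k ig).
Qed.

Lemma ge0_integrable_or_pinfty g : lebesgue_measurable_on `[a, b] g ->
  (forall t, t \in `[a, b] -> 0 <= g t) ->
  lebesgue_integrable_on `[a, b] g \/ lebesgue_int `[a, b] g = +oo%E.
Proof.
move=> mg g0; have [lty|] := ltP (lebesgue_int `[a, b] g) +oo%E; last first.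
  by rewrite leye_eq => /eqP; right.
left; apply/integrableP; split; first exact/measurable_EFinP.
apply: le_lt_trans lty.
rewrite /lebesgue_int le_eqVlt; apply/orP; left; apply/eqP.
by apply: eq_integral => t; rewrite inE => Dt; rewrite abse_EFin ger0_norm// g0.
Qed.

Hypothesis ab : a < b.
Let ba0 : 0 < b - a. Proof. by rewrite subr_gt0. Qed.

Lemma horner_integral (P : {poly R}) g : g =1 horner P^`() ->
  lebesgue_integrable_on `[a, b] g /\
  \int[cmu]_(t in `[a, b]) g t = P.[b] - P.[a].
Proof.
move=> /funext ->; have [iP eP] := lebesgue_int_deriv_horner P ab.
split=> //; apply: EFin_inj; rewrite -eP; exact/esym/lebesgue_int_Rintegral.
Qed.

Lemma cst_integral (c : R) : lebesgue_integrable_on `[a, b] (fun=> c) /\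
  \int[cmu]_(_ in `[a, b]) c = c * (b - a).
Proof.
have [|ic ec] := @horner_integral (c *: 'X) (fun=> c).
  by move=> t; rewrite derivZ derivX !hornerE.
by split=> //; rewrite ec !hornerE mulrBr.
Qed.

Lemma quadratic_integral (p q r : R) :
  lebesgue_integrable_on `[a, b]
    (fun t => p * (b - t) + q * (t - a) + r * ((b - t) * (t - a))) /\
  \int[cmu]_(t in `[a, b]) (p * (b - t) + q * (t - a) + r * ((b - t) * (t - a)))
  = (p + q) * ((b - a) ^+ 2 / 2) + r * ((b - a) ^+ 3 / 6).
Proof.
(* An antiderivative, since (b - t) * (t - a) = (b - a) * (t - a) - (t - a) ^+ 2 *)
pose P : {poly R} := (- p / 2) *: (b%:P - 'X) ^+ 2
  + ((q + r * (b - a)) / 2) *: ('X - a%:P) ^+ 2 - (r / 3) *: ('X - a%:P) ^+ 3.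
have [|iP eP] := @horner_integral P
  (fun t => p * (b - t) + q * (t - a) + r * ((b - t) * (t - a))).
  move=> t; rewrite /P !(derivD, derivN, derivZ, deriv_exp, derivC, derivX).
  by rewrite !hornerE/=; field.
by split=> //; rewrite eP /P !hornerE/=; field.
Qed.

(** By reflection invariance, both terms of the average have the integral of
    [f]. The signed function [e] stands for a gain as well as for the opposite of
    an error. *)
Lemma midpoint_integral f e :
  lebesgue_integrable_on `[a, b] f -> lebesgue_integrable_on `[a, b] e ->
  (forall t, t \in `[a, b] ->
     f ((a + b) / 2) + e t <= (f t + f (a + b - t)) / 2) ->
  f ((a + b) / 2) * (b - a) + \int[cmu]_(t in `[a, b]) e t <=
  \int[cmu]_(t in `[a, b]) f t.
Proof.
move=> intf ie h; set c := f ((a + b) / 2).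
have [ifr efr] := integral_reflection intf.
have [ic ec] := cst_integral c.
have {}efr : \int[cmu]_(t in `[a, b]) f (a + b - t) =
    \int[cmu]_(t in `[a, b]) f t.
  by apply: EFin_inj; rewrite -!lebesgue_int_Rintegral.
have isum : lebesgue_integrable_on `[a, b] (fun t => f t + f (a + b - t)).
  exact: lebesgue_integrable_onD.
have il : lebesgue_integrable_on `[a, b] (fun t => c + e t).
  exact: lebesgue_integrable_onD.
have ir : lebesgue_integrable_on `[a, b] (fun t => 2^-1 * (f t + f (a + b - t))).
  exact: lebesgue_integrable_onZ.
have := le_Rintegral mD il ir; rewrite -/c in h => /(_ _)/wrap[t Dt|].
  by rewrite mulrC; exact: h.
rewrite (RintegralD mD ic ie) ec (RintegralZl _ mD isum).
rewrite (RintegralD mD intf ifr) efr.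
by move=> /le_trans; apply; lra.
Qed.

(** The chord plus a multiple of [(b - t) * (t - a)] is integrated exactly; [e]
    is the error that is not a polynomial. *)
Lemma chord_integral f e (r : R) :
  lebesgue_integrable_on `[a, b] f -> lebesgue_integrable_on `[a, b] e ->
  (forall t, t \in `[a, b] ->
     f t <= ((b - t) * f a + (t - a) * f b) / (b - a)
            - r * ((b - t) * (t - a)) + e t) ->
  \int[cmu]_(t in `[a, b]) f t <=
  (b - a) * ((f a + f b) / 2) - r * ((b - a) ^+ 3 / 6)
  + \int[cmu]_(t in `[a, b]) e t.
Proof.
move=> intf ie h.
have ba_neq0 : b - a != 0 by rewrite gt_eqF.
have [iq eq_] := quadratic_integral (f a / (b - a)) (f b / (b - a)) (- r).
have ir := lebesgue_integrable_onD iq ie.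
have := le_Rintegral mD intf ir.
rewrite (RintegralD mD iq ie) eq_ => /(_ _)/le_trans; apply.
  move=> t Dt; apply: le_trans (h t Dt) _.
  by rewrite le_eqVlt; apply/orP; left; apply/eqP; field.
by rewrite le_eqVlt; apply/orP; left; apply/eqP; field.
Qed.

Lemma measurable_dist_comp g : lebesgue_measurable_on `[0, b - a] g ->
  lebesgue_measurable_on `[a, b] (fun t => g `|t - (a + b) / 2|).
Proof.
move=> mg.
apply: (measurable_comp
  (g := (fun t : lebesgueR R => `|t - (a + b) / 2| : lebesgueR R)) _ _ mg).
- exact: itv_lebesgue_measurable.
- move=> _ [t /= + <-]; rewrite !in_itv/= => /andP[? ?]; rewrite normr_ge0/=.
  by have := ab; rewrite ler_norml => ?; apply/andP; split; lra.
- exact/measurable_funTS/lebesgue_measurable_dist.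
Qed.

Lemma measurable_chord_error g : lebesgue_measurable_on `[0, b - a] g ->
  lebesgue_measurable_on `[a, b]
    (fun t => (b - t) * g (t - a) + (t - a) * g (b - t)).
Proof.
move=> mg.
have mD0 : measurable (`[0, b - a]%classic : set (lebesgueR R)).
  exact: itv_lebesgue_measurable.
have m1 : lebesgue_measurable_on `[a, b] (fun t => g (t - a)).
  apply: (measurable_comp
    (g := (fun t : lebesgueR R => t - a : lebesgueR R)) mD0 _ mg).
    move=> _ [t /= + <-]; rewrite !in_itv/= => /andP[? ?].
    by apply/andP; split; lra.
  exact/measurable_funTS/lebesgue_measurable_translation.
have m2 : lebesgue_measurable_on `[a, b] (fun t => g (b - t)).
  apply: (measurable_comp
    (g := (fun t : lebesgueR R => b - t : lebesgueR R)) mD0 _ mg).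
    move=> _ [t /= + <-]; rewrite !in_itv/= => /andP[? ?].
    by apply/andP; split; lra.
  exact/measurable_funTS/lebesgue_measurable_reflection.
have mi : measurable_fun D (fun t : lebesgueR R => t : R).
  exact: measurable_funS measurableT (@subsetT _ D) lebesgue_measurable_id.
have mc (c : R) : measurable_fun D (fun=> c) := measurable_cst c.
apply: measurable_funD; apply: measurable_funM => //.
- exact: measurable_funB (mc b) mi.
- exact: measurable_funB mi (mc a).
Qed.

End Integrated.

(** * The four inequalities *)

Section HermiteHadamard.
Local Set Implicit Arguments.
Local Unset Strict Implicit.
Context {R : realType}.
Variables (a b : R) (f phi : R -> R).
Hypotheses (ab : a < b) (intf : lebesgue_integrable_on `[a, b] f).
Let D : set (lebesgueR R) := `[a, b].
Let mD : measurable D. Proof. exact: itv_lebesgue_measurable. Qed.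
Let ba0 : 0 < b - a. Proof. by rewrite subr_gt0. Qed.
Let ba_neq0 : b - a != 0. Proof. by rewrite gt_eqF. Qed.
Let dist_phi t := phi `|t - (a + b) / 2|.
Let chord_phi t := (b - t) * phi (t - a) + (t - a) * phi (b - t).

Let le_mean (x y : R) : x * (b - a) <= y -> x <= (b - a)^-1 * y.
Proof. by move=> h; rewrite ler_pdivlMl// mulrC. Qed.

Let dist_phi_ge0 : (forall r, r \in `[0, b - a] -> 0 <= phi r) ->
  forall t, t \in `[a, b] -> 0 <= dist_phi t.
Proof.
move=> phi0 t; rewrite in_itv/= => /andP[? ?]; apply: phi0.
by rewrite in_itv/= normr_ge0/= ler_norml; apply/andP; split; lra.
Qed.

Lemma uniformly_convex_mean_le : uniformly_convex a b phi f ->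
  (((b - a)^-1)%:E * lebesgue_int `[a, b] f
   <= ((f a + f b) / 2 - 1 / 6 * phi `|b - a|)%:E)%E.
Proof.
move=> cf; rewrite gtr0_norm//.
have [ic ec] := cst_integral ab 0.
rewrite lebesgue_int_Rintegral// -EFinM lee_fin ler_pdivrMl//.
have := @chord_integral _ _ _ ab f (fun=> 0) (phi (b - a) / (b - a) ^+ 2) intf ic.
rewrite ec => /(_ _)/wrap[t tab|/le_trans]; last apply.
  by rewrite addr0; exact: uniformly_convex_chord.
by rewrite le_eqVlt; apply/orP; left; apply/eqP; field.
Qed.

Hypothesis mphi : lebesgue_measurable_on `[0, b - a] phi.

Lemma phi_convex_mean_ge : phi_convex a b phi f ->
  ((f ((a + b) / 2))%:E - ((b - a)^-1)%:E * lebesgue_int `[a, b] dist_phi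
   <= ((b - a)^-1)%:E * lebesgue_int `[a, b] f)%E.
Proof.
move=> cf.
have [ie|->] := ge0_integrable_or_pinfty
    (measurable_dist_comp ab mphi) (dist_phi_ge0 cf.1); last first.
  by rewrite gt0_muley ?lte_fin ?invr_gt0// addeNy leNye.
rewrite !lebesgue_int_Rintegral// -!EFinM -EFinB lee_fin.
have := @midpoint_integral _ _ _ ab f (fun t => -1 * dist_phi t) intf
  (lebesgue_integrable_onZ _ ie).
rewrite RintegralZl// => /(_ _)/wrap[t tab|h].
  by have := phi_convex_midpoint cf tab; rewrite /dist_phi; lra.
rewrite lerBlDl -mulrDr; apply: le_mean; lra.
Qed.

Lemma phi_convex_mean_le : phi_convex a b phi f ->
  (((b - a)^-1)%:E * lebesgue_int `[a, b] f
   <= ((f a + f b) / 2)%:E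
      + (((b - a) ^+ 2)^-1)%:E * lebesgue_int `[a, b] chord_phi)%E.
Proof.
move=> cf.
have phi0 t : t \in `[a, b] -> 0 <= chord_phi t.
  rewrite in_itv/= => /andP[? ?].
  apply: addr_ge0; apply: mulr_ge0; rewrite ?subr_ge0//;
  by apply: cf.1; rewrite in_itv/=; apply/andP; split; lra.
have [ie|->] := ge0_integrable_or_pinfty
    (measurable_chord_error mphi) phi0; last first.
  by rewrite gt0_muley ?lte_fin ?invr_gt0 ?exprn_gt0// addey// leey.
rewrite !lebesgue_int_Rintegral// -!EFinM -EFinD lee_fin.
have := @chord_integral _ _ _ ab f (fun t => (b - a)^-1 * chord_phi t) 0 intf
  (lebesgue_integrable_onZ _ ie).
rewrite RintegralZl// => /(_ _)/wrap[t tab|h].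
  have := phi_convex_chord ab cf tab.
  by rewrite mul0r subr0 [_^-1 * _]mulrC.
rewrite ler_pdivrMl//; apply: le_trans h _.
by rewrite le_eqVlt; apply/orP; left; apply/eqP; field.
Qed.

Lemma uniformly_convex_mean_ge : uniformly_convex a b phi f ->
  ((f ((a + b) / 2))%:E + ((b - a)^-1)%:E * lebesgue_int `[a, b] dist_phi
   <= ((b - a)^-1)%:E * lebesgue_int `[a, b] f)%E.
Proof.
move=> cf.
have mid t := @uniformly_convex_midpoint _ _ _ f phi ab t cf.
have d0 := dist_phi_ge0 cf.1.
have [ifr _] := integral_reflection intf.
have [ic _] := cst_integral ab (- f ((a + b) / 2)).
have ib := lebesgue_integrable_onD
  (lebesgue_integrable_onZ 2^-1 (lebesgue_integrable_onD intf ifr)) ic.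
(* The midpoint inequality itself dominates the gain by an integrable function *)
have ie : lebesgue_integrable_on `[a, b] dist_phi.
  apply: (le_integrable mD _ _ ib).
    exact/measurable_EFinP/(measurable_dist_comp ab mphi).
  move=> t Dt; rewrite !abse_EFin lee_fin ger0_norm ?d0//.
  by apply: le_trans (ler_norm _); have := mid t Dt; rewrite /dist_phi; lra.
rewrite !lebesgue_int_Rintegral// -!EFinM -EFinD lee_fin.
have h := midpoint_integral ab intf ie mid.
rewrite -lerBrDr -mulrBr; apply: le_mean; lra.
Qed.

End HermiteHadamard.

Theorem theorem11 (R : realType) (a b : R) (hab : a < b) :
  (forall f phi : R -> R,
     lebesgue_integrable_on `[a, b] f ->
     lebesgue_measurable_on `[0, b - a] phi ->
     phi_convex a b phi f ->
     ((f ((a + b) / 2))%:E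
        - ((b - a)^-1)%:E * lebesgue_int `[a, b] (fun t => phi `|t - (a + b) / 2|)%R
      <= ((b - a)^-1)%:E * lebesgue_int `[a, b] f)%E
     /\
     (((b - a)^-1)%:E * lebesgue_int `[a, b] f
      <= ((f a + f b) / 2)%:E
         + (((b - a) ^+ 2)^-1)%:E *
             lebesgue_int `[a, b]
               (fun t => (b - t) * phi (t - a) + (t - a) * phi (b - t))%R)%E)
  /\
  (forall f Phi : R -> R,
     lebesgue_integrable_on `[a, b] f ->
     lebesgue_measurable_on `[0, b - a] Phi ->
     uniformly_convex a b Phi f ->
     ((f ((a + b) / 2))%:E
        + ((b - a)^-1)%:E * lebesgue_int `[a, b] (fun t => Phi `|t - (a + b) / 2|)%R
      <= ((b - a)^-1)%:E * lebesgue_int `[a, b] f)%E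
     /\
     (((b - a)^-1)%:E * lebesgue_int `[a, b] f
      <= ((f a + f b) / 2 - 1 / 6 * Phi `|b - a|)%:E)%E).
Proof.
split=> f phi intf mphi cf; split.
- exact: phi_convex_mean_ge.
- exact: phi_convex_mean_le.
- exact: uniformly_convex_mean_ge.
- exact: uniformly_convex_mean_le.
Qed.
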